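(* Let $A$ be an algebra in a semidegenerate congruence modular variety such that $K(A)$ is closed under the commutator. If the map $B(Con(A))\rightarrow Clop(Spec(A))$, $\alpha\mapsto D_A(\alpha)$, is a Boolean isomorphism, then the reticulation of $A$ preserves the Boolean center.
   Context: $\mathcal{V}$ is a congruence modular, semidegenerate variety (no nontrivial algebra has a one-element subalgebra; equivalently $\nabla_A$ is compact) of finite signature; $A\in\mathcal{V}$. $Con(A)$ is the congruence lattice with bounds $\Delta_A,\nabla_A$, $[\cdot,\cdot]$ the Freese–McKenzie commutator, $K(A)$ the compact congruences. A congruence $\phi\neq\nabla_A$ is prime if $[\alpha,\beta]\subseteq\phi$ implies $\alpha\subseteq\phi$ or $\beta\subseteq\phi$; $Spec(A)$ is the set of primes; $\rho(\theta)$ is the intersection of primes containing $\theta$; $V_A(\theta)=\{\phi\in Spec(A):\theta\subseteq\phi\}$, $D_A(\theta)=Spec(A)\setminus V_A(\theta)$, and the sets $D_A(\theta)$ form the topology on $Spec(A)$. $Clop(X)$ is the Boolean algebra of clopen subsets of $X$. $B(Con(A))$ is the Boolean algebra of complemented elements of $Con(A)$; for $\alpha\in B(Con(A))$, $D_A(\alpha)$ is clopen. The reticulation $L(A)=K(A)/{\equiv}$ ($\alpha\equiv\beta$ iff $\rho(\alpha)=\rho(\beta)$) is a bounded distributive lattice with canonical map $\lambda_A:K(A)\to L(A)$, which maps $B(Con(A))$ injectively into $B(L(A))$ (complemented elements of $L(A)$). The reticulation of $A$ preserves the Boolean center if $\lambda_A|_{B(Con(A))}:B(Con(A))\to B(L(A))$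 is surjective. *)

(* Defs.v *)
From Stdlib Require Import List.
From mathcomp Require Import all_boot.

Set Implicit Arguments.
Unset Strict Implicit.
Unset Printing Implicit Defensive.

Section UniversalAlgebra.

Variables (sig : finType) (ar : sig -> nat).

Record algebra := Algebra {
  carrier :> Type;
  op : forall f : sig, ('I_(ar f) -> carrier) -> carrier
}.

Inductive term (V : Type) : Type :=
| Var : V -> term V
| App : forall f : sig, ('I_(ar f) -> term V) -> term V.

Fixpoint eval (A : algebra) (V : Type) (e : V -> A) (t : term V) : A :=
  match t with
  | Var v => e v
  | App f args => @op A f (fun i => eval e (args i))
  end.

(* Identities are pairs of terms over countably many variables;
   a variety is the class Mod(Sigma) of models of a set Sigma of identities. *)
Definition identities := term nat -> term nat -> Prop.

Definition models (Sigma : identities) (A : algebra) : Prop :=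
  forall s t, Sigma s t -> forall e : nat -> A, eval e s = eval e t.

Definition relA (A : algebra) := A -> A -> Prop.

Definition is_cong (A : algebra) (th : relA A) : Prop :=
  [/\ (forall x, th x x),
      (forall x y, th x y -> th y x),
      (forall x y z, th x y -> th y z -> th x z) &
      (forall (f : sig) (a b : 'I_(ar f) -> A),
          (forall i, th (a i) (b i)) -> th (@op A f a) (@op A f b))].

Definition subrel (A : algebra) (a b : relA A) : Prop := forall x y, a x y -> b x y.
Definition releq (A : algebra) (a b : relA A) : Prop := subrel a b /\ subrel b a.

Definition Delta (A : algebra) : relA A := fun x y => x = y.
Definition Nabla (A : algebra) : relA A := fun _ _ => True.

Definition cmeet (A : algebra) (a b : relA A) : relA A := fun x y => a x y /\ b x y.

Definition bigjoin (A : algebra) (S : relA A -> Prop) : relA A :=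
  fun x y => forall g : relA A, is_cong g -> (forall a, S a -> subrel a g) -> g x y.

Definition cjoin (A : algebra) (a b : relA A) : relA A :=
  fun x y => forall g : relA A, is_cong g -> subrel a g -> subrel b g -> g x y.

Definition compact (A : algebra) (th : relA A) : Prop :=
  forall S : relA A -> Prop, (forall a, S a -> is_cong a) ->
    subrel th (bigjoin S) ->
    exists l : list (relA A), (forall a, In a l -> S a) /\
                              subrel th (bigjoin (fun a => In a l)).

Definition KA (A : algebra) (th : relA A) : Prop := is_cong th /\ compact th.

Definition centralizes (A : algebra) (a b d : relA A) : Prop :=
  forall (m n : nat) (t : term ('I_m + 'I_n)%type)
         (x y : 'I_m -> A) (u v : 'I_n -> A),
    (forall i, a (x i) (y i)) -> (forall j, b (u j) (v j)) ->
    d (eval (fun w => match w with inl i => x i | inr j => u j end) t)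
      (eval (fun w => match w with inl i => x i | inr j => v j end) t) ->
    d (eval (fun w => match w with inl i => y i | inr j => u j end) t)
      (eval (fun w => match w with inl i => y i | inr j => v j end) t).

Definition comm (A : algebra) (a b : relA A) : relA A :=
  fun x y => forall d : relA A, is_cong d -> centralizes a b d -> d x y.

Definition prime_cong (A : algebra) (p : relA A) : Prop :=
  [/\ is_cong p, ~ releq p (@Nabla A) &
      forall a b : relA A, is_cong a -> is_cong b -> subrel (comm a b) p ->
                  subrel a p \/ subrel b p].

Definition rho (A : algebra) (th : relA A) : relA A :=
  fun x y => forall p : relA A, prime_cong p -> subrel th p -> p x y.

(* Subsets of Spec(A) are predicates on relations (only their values on primes
   matter).  V_A, D_A and the topology. *)
Definition VA (A : algebra) (th : relA A) : relA A -> Prop :=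
  fun p => prime_cong p /\ subrel th p.
Definition DA (A : algebra) (th : relA A) : relA A -> Prop :=
  fun p => prime_cong p /\ ~ subrel th p.

Definition speceq (A : algebra) (U W : relA A -> Prop) : Prop :=
  forall p : relA A, prime_cong p -> (U p <-> W p).

Definition spec_open (A : algebra) (U : relA A -> Prop) : Prop :=
  exists th : relA A, is_cong th /\ speceq U (DA th).

Definition spec_compl (A : algebra) (U : relA A -> Prop) : relA A -> Prop :=
  fun p => prime_cong p /\ ~ U p.

Definition spec_clopen (A : algebra) (U : relA A -> Prop) : Prop :=
  spec_open U /\ spec_open (spec_compl U).

Definition complemented_cong (A : algebra) (a : relA A) : Prop :=
  is_cong a /\ exists b : relA A, [/\ is_cong b, releq (cmeet a b) (@Delta A) &
                             releq (cjoin a b) (@Nabla A)].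

Definition D_boolean_iso (A : algebra) : Prop :=
  [/\ (forall a b : relA A, complemented_cong a -> complemented_cong b ->
         speceq (DA a) (DA b) -> releq a b),
      (forall U : relA A -> Prop, spec_clopen U ->
         exists a : relA A, complemented_cong a /\ speceq U (DA a)),
      (forall a b : relA A, complemented_cong a -> complemented_cong b ->
         speceq (DA (cmeet a b)) (fun p => DA a p /\ DA b p)),
      (forall a b : relA A, complemented_cong a -> complemented_cong b ->
         speceq (DA (cjoin a b)) (fun p => DA a p \/ DA b p)) &
      (speceq (DA (@Delta A)) (fun _ => False) /\
       speceq (DA (@Nabla A)) (fun _ => True))].

(* Reticulation L(A) = K(A)/==, a == b iff rho a = rho b, with
   lambda(a) \/ lambda(b) = lambda(a \/ b), lambda(a) /\ lambda(b) = lambda([a,b]),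
   0 = lambda(Delta), 1 = lambda(Nabla).
   lambda(a) (a in K(A)) lies in B(L(A)) iff it has a complement in L(A). *)
Definition lambda_complemented (A : algebra) (a : relA A) : Prop :=
  exists b : relA A, [/\ KA b, releq (rho (comm a b)) (rho (@Delta A)) &
               releq (rho (cjoin a b)) (rho (@Nabla A))].

Definition K_comm_closed (A : algebra) : Prop :=
  forall a b : relA A, KA a -> KA b -> KA (comm a b).

Definition cong_modular_variety (Sigma : identities) : Prop :=
  forall B : algebra, models Sigma B ->
    forall a b c : relA B, is_cong a -> is_cong b -> is_cong c -> subrel a c ->
      releq (cjoin a (cmeet b c)) (cmeet (cjoin a b) c).

Definition semidegenerate_variety (Sigma : identities) : Prop :=
  forall B : algebra, models Sigma B ->
    (exists x y : B, x <> y) ->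
    ~ (exists x : B, forall f : sig, @op B f (fun _ => x) = x).

(* The reticulation preserves the Boolean center: lambda_A restricted to
   B(Con(A)) maps onto B(L(A)). *)
Definition reticulation_preserves_boolean_center (A : algebra) : Prop :=
  forall a : relA A, KA a -> lambda_complemented a ->
    exists g : relA A, [/\ complemented_cong g, KA g & releq (rho g) (rho a)].

End UniversalAlgebra.

(* Main.v *)
From Stdlib Require Import List Classical ClassicalEpsilon.
From Stdlib Require Import PropExtensionality FunctionalExtensionality.
From Stdlib Require Import ProofIrrelevance.
Require Import Defs.
From mathcomp Require Import all_boot.
(* Defs again, so that [subrel] is the relation on congruences and not the
   one of ssrbool. *)
Import Defs.

Set Implicit Arguments.
Unset Strict Implicit.
Unset Printing Implicit Defensive.

(** If [lambda a] has complement [lambda b] in the reticulation, then every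
    prime contains exactly one of [a] and [b]; hence [DA a] is clopen, so it
    equals [DA g] for some complemented congruence [g], and [rho g = rho a].
    It remains to see that [g] is compact.  Semidegeneracy forces a congruence
    that identifies some [x] with [f(x,...,x)] for every basic operation [f] to
    be [Nabla], since the class of [x] is a one-element subalgebra of the
    quotient; as the signature is finite, a directed union of congruences that
    is [Nabla] has a member equal to [Nabla].  If [h] is a complement of [g] and
    [g] is below the join of [S], this applies to the congruences
    [(g /\ \/ l) \/ h] for [l] a finite part of [S], and by modularity
    [(g /\ \/ l) \/ h = Nabla] gives [g <= \/ l]. *)

(** * Joins and meets of congruences, radicals and primes *)

Section Congruences.

Variables (sig : finType) (ar : sig -> nat) (A : algebra ar).
Implicit Types (a b c g h th p : relA A) (S : relA A -> Prop).

Lemma bigjoin_cong S : is_cong (bigjoin S).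
Proof.
split.
- by move=> x g [].
- by move=> x y xy g cg Sg; case: (cg) => _ s _ _; apply: s; apply: xy.
- move=> x y z xy yz g cg Sg; case: (cg) => _ _ t _.
  by apply: t (xy g cg Sg) (yz g cg Sg).
- move=> f u v uv g cg Sg; case: (cg) => _ _ _ o.
  by apply: o => i; apply: uv.
Qed.

Lemma cjoin_cong a b : is_cong (cjoin a b).
Proof.
split.
- by move=> x g [].
- by move=> x y xy g cg ag bg; case: (cg) => _ s _ _; apply: s; apply: xy.
- move=> x y z xy yz g cg ag bg; case: (cg) => _ _ t _.
  by apply: t (xy g cg ag bg) (yz g cg ag bg).
- move=> f u v uv g cg ag bg; case: (cg) => _ _ _ o.
  by apply: o => i; apply: uv.
Qed.

Lemma cmeet_cong a b : is_cong a -> is_cong b -> is_cong (cmeet a b).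
Proof.
move=> [ra sa ta oa] [rb sb tb ob]; split.
- by move=> x; split.
- by move=> x y [xy xy']; split; [apply: sa | apply: sb].
- by move=> x y z [xy xy'] [yz yz']; split; [apply: ta yz | apply: tb yz'].
- by move=> f u v uv; split; [apply: oa | apply: ob] => i; case: (uv i).
Qed.

Lemma bigjoin_sub S th : S th -> subrel th (bigjoin S).
Proof. by move=> Sth x y xy g _ /(_ th Sth); apply. Qed.

Lemma cjoin_subl a b : subrel a (cjoin a b).
Proof. by move=> x y xy g _ ag _; apply: ag. Qed.

Lemma cjoin_subr a b : subrel b (cjoin a b).
Proof. by move=> x y xy g _ _; apply. Qed.

Lemma prime_rho p th : prime_cong p -> subrel th p -> subrel (rho th) p.
Proof. by move=> pp thp x y; apply. Qed.

Lemma sub_rho th : subrel th (rho th).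
Proof. by move=> x y xy p _; apply. Qed.

Lemma Delta_sub th : is_cong th -> subrel (@Delta _ _ A) th.
Proof. by move=> [r _ _ _] x _ <-. Qed.

Lemma prime_neq_Nabla p : prime_cong p -> ~ subrel (@Nabla _ _ A) p.
Proof. by move=> [_ np _] Np; apply: np; split. Qed.

(** * Directed unions of congruences indexed by finite parts of [S] *)

Section DirectedUnion.

Variables (S : relA A -> Prop) (F : list (relA A) -> relA A).
Hypothesis F_cong : forall l, is_cong (F l).
Hypothesis F_mono : forall l m, incl l m -> subrel (F l) (F m).

Definition finite_part (l : list (relA A)) := forall th, In th l -> S th.

Lemma finite_part_app l m :
  finite_part l -> finite_part m -> finite_part (l ++ m).
Proof. by move=> lS mS th /in_app_iff[/lS | /mS]. Qed.

Definition directed_union : relA A :=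
  fun x y => exists2 l, finite_part l & F l x y.

(** Concatenating the finitely many indices gives one that serves all pairs, by monotonicity. With
    [I] the argument places of an operation this yields compatibility; with [I] the signature it
    serves semidegeneracy. *)
Lemma directed_union_uniform (I : finType) (u v : I -> A) :
    (forall i, directed_union (u i) (v i)) ->
  exists2 l, finite_part l & forall i, F l (u i) (v i).
Proof.
move=> uv.
suff [l lS lF] : exists2 l, finite_part l &
    forall i, i \in enum I -> F l (u i) (v i).
  by exists l => // i; apply: lF; rewrite mem_enum.
elim: (enum I) => [|i s [l lS lF]]; first by exists nil.
have [m mS mF] := uv i.
exists (m ++ l); first exact: finite_part_app.
move=> j; rewrite inE => /orP[/eqP-> | js].
  exact: F_mono (@incl_appl _ m l m (@incl_refl _ m)) _ _ mF.
exact: F_mono (@incl_appr _ l m l (@incl_refl _ l)) _ _ (lF j js).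
Qed.

Lemma directed_union_cong : is_cong directed_union.
Proof.
split.
- by move=> x; exists nil => //; case: (F_cong nil).
- by move=> x y [l lS xy]; exists l => //; case: (F_cong l) => _ s _ _; apply: s.
- move=> x y z [l lS xy] [m mS yz].
  exists (l ++ m); first exact: finite_part_app.
  case: (F_cong (l ++ m)) => _ _ t _; apply: (t _ y).
    exact: F_mono (@incl_appl _ l m l (@incl_refl _ l)) _ _ xy.
  exact: F_mono (@incl_appr _ m l m (@incl_refl _ m)) _ _ yz.
- move=> f u v /directed_union_uniform[l lS uv].
  by exists l => //; case: (F_cong l) => _ _ _ o; apply: o.
Qed.

End DirectedUnion.

Lemma bigjoin_mono (l m : list (relA A)) :
  incl l m -> subrel (bigjoin (fun th => In th l)) (bigjoin (fun th => In th m)).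
Proof. by move=> lm x y xy g cg mg; apply: xy => // th /lm; apply: mg. Qed.

(** The directed union of the finite joins is itself a congruence above every member of [S], so it
    contains the least one. *)
Lemma bigjoin_finite S x y :
  bigjoin S x y -> directed_union S (fun l => bigjoin (fun th => In th l)) x y.
Proof.
apply; first exact: directed_union_cong (fun l => bigjoin_cong _) bigjoin_mono.
move=> th Sth u v uv; exists [:: th]; first by move=> _ [<-|[]].
by apply: bigjoin_sub uv; left.
Qed.

End Congruences.

(** * Quotient algebras *)

Section Quotient.

Variables (sig : finType) (ar : sig -> nat) (A : algebra ar) (th : relA A).
Hypothesis th_cong : is_cong th.

Definition class_repr (x : A) : A := epsilon (inhabits x) (th x).

Lemma class_reprP x : th x (class_repr x).
Proof.
by apply: (epsilon_spec (inhabits x)); exists x; case: th_cong.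
Qed.

(** Related elements have extensionally equal classes, and [epsilon] sees only the class, the
    witnesses of inhabitation being equal by proof irrelevance. *)
Lemma class_repr_eq x y : th x y -> class_repr x = class_repr y.
Proof.
case: th_cong => _ s t _ xy; rewrite /class_repr.
have -> : th x = th y.
  apply: functional_extensionality => z; apply: propositional_extensionality.
  by split; [apply: t (s _ _ xy) | apply: t xy].
by congr epsilon; apply: proof_irrelevance.
Qed.

Lemma class_repr_idem x : class_repr (class_repr x) = class_repr x.
Proof. by apply: esym; apply: class_repr_eq; apply: class_reprP. Qed.

(* The quotient is carried by the chosen representatives of the classes. *)
Definition quotient_carrier := {x : A | class_repr x = x}.

Definition quotient_proj (x : A) : quotient_carrier :=
  exist _ (class_repr x) (class_repr_idem x).

Definition quotient : algebra ar :=
  Algebra (fun f (u : 'I_(ar f) -> quotient_carrier) =>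
             quotient_proj (op (fun i => sval (u i)))).

Lemma quotient_proj_eq x y : th x y -> quotient_proj x = quotient_proj y.
Proof.
move=> xy; apply: eq_sig_hprop => /=; last exact: class_repr_eq.
by move=> z; apply: proof_irrelevance.
Qed.

Lemma quotient_proj_sval (x : quotient_carrier) : quotient_proj (sval x) = x.
Proof.
case: x => x rx /=; apply: eq_sig_hprop => //= z.
exact: proof_irrelevance.
Qed.

Lemma quotient_proj_inj x y : quotient_proj x = quotient_proj y -> th x y.
Proof.
case: th_cong => _ s t _ /(congr1 sval) /= xy.
by apply: t (class_reprP x) _; rewrite xy; apply: s; apply: class_reprP.
Qed.

Lemma quotient_eval (V : Type) (e : V -> quotient) (t : term ar V) :
  eval e t = quotient_proj (eval (fun v => sval (e v)) t).
Proof.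
case: th_cong => _ s _ o.
elim: t => [v | f u IH] /=; first by rewrite quotient_proj_sval.
apply: quotient_proj_eq; apply: o => i; rewrite IH.
by apply: s; apply: class_reprP.
Qed.

Lemma quotient_models (Sigma : identities ar) :
  models Sigma A -> models Sigma quotient.
Proof.
by move=> AS s t st e; rewrite !quotient_eval (AS s t st).
Qed.

End Quotient.

(** * Semidegeneracy and compactness of complemented congruences *)

Section Semidegenerate.

Variables (sig : finType) (ar : sig -> nat) (Sigma : identities ar).
Variable A : algebra ar.
Hypothesis Sigma_semidegenerate : semidegenerate_variety Sigma.
Hypothesis A_models : models Sigma A.

Lemma idempotent_class_Nabla (th : relA A) (x : A) :
    is_cong th -> (forall f, th x (op (fun _ : 'I_(ar f) => x))) ->
  subrel (@Nabla _ _ A) th.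
Proof.
move=> cth xf y z _; apply: NNPP => nyz.
case: (Sigma_semidegenerate (quotient_models (th_cong := cth) A_models)).
  exists (quotient_proj cth y), (quotient_proj cth z).
  by move/quotient_proj_inj/nyz.
exists (quotient_proj cth x) => f /=.
apply: quotient_proj_eq; case: (cth) => _ s t o.
apply: t (s _ _ (xf f)); apply: o => _.
by apply: s; apply: class_reprP.
Qed.

Lemma directed_union_Nabla (S : relA A -> Prop) (F : list (relA A) -> relA A) :
    (forall l, is_cong (F l)) ->
    (forall l m, incl l m -> subrel (F l) (F m)) ->
    subrel (@Nabla _ _ A) (directed_union S F) ->
  exists2 l, finite_part S l & subrel (@Nabla _ _ A) (F l).
Proof.
move=> Fc Fm FN.
(* On an empty carrier the empty list works vacuously. *)
have [[x] | A0] := classic (inhabited A); last first.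
  by exists nil => // x; case: A0.
have [f | l lS lF] := directed_union_uniform Fm
  (u := fun _ => x) (v := fun f : sig => op (fun _ : 'I_(ar f) => x)) (S := S).
  exact: FN.
by exists l => //; apply: idempotent_class_Nabla lF.
Qed.

Hypothesis Sigma_modular : cong_modular_variety Sigma.

Lemma complemented_compact (g : relA A) : complemented_cong g -> compact g.
Proof.
move=> [cg [h [ch gh0 gh1]]] S _ gS.
pose J l := bigjoin (fun th : relA A => In th l).
pose F l := cjoin (cmeet g (J l)) h.
have Jc l : is_cong (J l) by apply: bigjoin_cong.
have Fc l : is_cong (F l) by apply: cjoin_cong.
have Fm l m : incl l m -> subrel (F l) (F m).
  move=> /bigjoin_mono lm x y xy; apply: (xy _ (Fc m)); last exact: cjoin_subr.
  by move=> u v [gu lu]; apply: cjoin_subl; split=> //; apply: lm.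
(* The union of the [F l] contains [g], as [g] is below the join of [S], and also [h]; so it
   contains [cjoin g h], which is [Nabla]. *)
have [x y _ | l lS FN] := directed_union_Nabla (S := S) Fc Fm.
  apply: (gh1.2 x y I); first exact: directed_union_cong.
    move=> u v guv; have [l lS luv] := bigjoin_finite (gS _ _ guv).
    by exists l => //; apply: cjoin_subl; split.
  by move=> u v huv; exists nil => //; apply: cjoin_subr.
exists l; split=> // x y gxy.
(* The modular law for [cmeet g (J l)] below [g] puts [g], which is its meet with [F l], under the
   join of [cmeet g (J l)] and [cmeet h g]; the latter is [Delta]. *)
have [u v [] // | _ modr] :=
  Sigma_modular A_models (cmeet_cong cg (Jc l)) ch cg.
apply: (modr x y (conj (FN x y I) gxy) (J l) (Jc l)) => u v [] // hu gu.
by apply: (Delta_sub (Jc l)); apply: gh0.1.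
Qed.

End Semidegenerate.

(** * Complements in the reticulation and the spectrum *)

Lemma lambda_complement_prime (sig : finType) (ar : sig -> nat) (A : algebra ar)
    (a b p : relA A) :
    is_cong a -> is_cong b ->
    releq (rho (comm a b)) (rho (@Delta _ _ A)) ->
    releq (rho (cjoin a b)) (rho (@Nabla _ _ A)) ->
  prime_cong p -> subrel b p <-> ~ subrel a p.
Proof.
move=> ca cb [ab0 _] [_ ab1] pp; have [cp _ prime_p] := pp.
split=> [bp ap | nap].
  apply: (prime_neq_Nabla pp) => x y /sub_rho/ab1; apply: prime_rho => //.
  by move=> u v uv; apply: uv.
(* [comm a b] lies in [rho] of [Delta], hence in [p], and primeness selects a factor. *)
have [x y xy | // | //] := prime_p a b ca cb.
exact: prime_rho pp (Delta_sub cp) _ _ (ab0 _ _ (sub_rho xy)).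
Qed.

Theorem theorem4p11 (sig : finType) (ar : sig -> nat) (Sigma : identities ar)
    (A : algebra ar) :
  cong_modular_variety Sigma ->
  semidegenerate_variety Sigma ->
  models Sigma A ->
  K_comm_closed A ->
  D_boolean_iso A ->
  reticulation_preserves_boolean_center A.
Proof.
move=> modS semiS AS _ [_ D_surj _ _ _] a [ca _] [b [[cb _] ab0 ab1]].
have ab p := lambda_complement_prime ca cb ab0 ab1 (p := p).
have [|g [gc ag]] := D_surj (DA a).
  split; first by exists a.
  (* The complement of [DA a] is open because it is [DA b]. *)
  exists b; split=> // p pp; have abp := ab p pp; split=> [[_ nDa]|[_ nbp]].
    by split=> // /abp nap; apply: nDa.
  by split=> // -[_ /abp].
have sub_ag p : prime_cong p -> subrel a p <-> subrel g p.
  move=> pp; have [ag1 ga1] := ag p pp.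
  split=> sp; apply: NNPP => nsp.
    by case: ga1.
  by case: ag1.
exists g; split=> //.
  by split; [case: gc | exact: (complemented_compact semiS AS modS gc)].
by split=> x y xy p pp /(sub_ag p pp); apply: xy.
Qed.
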